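(* For the online conversion problem with switching costs, minimization variant (OCS-min), with parameters $0<L<U$ and $\beta\in(0,\tfrac{U-L}{2})$, no deterministic online algorithm can achieve a competitive ratio better than $$\alpha=\left[W\!\left(\left(\frac{2\beta}{U}+\frac{L}{U}-1\right)e^{\frac{2\beta}{U}-1}\right)-\frac{2\beta}{U}+1\right]^{-1},$$ where $W$ denotes the Lambert $W$ function (inverse of $x\mapsto xe^x$).
   Context: OCS-min: Fix a horizon $T$, known rate constraints $d_1,\dots,d_T\in(0,1]$, known constants $0<L<U$ and switching cost coefficient $\beta\in(0,(U-L)/2)$. An instance is a sequence of convex cost functions $g_1,\dots,g_T:[0,1]\to\mathbb{R}_{\ge0}$ with $g_t(0)=0$ and $L\le g_t'(x)\le U$. A feasible solution is $x_1,\dots,x_T$ with $x_t\in[0,d_t]$, $\sum_t x_t=1$; with $x_0=x_{T+1}=0$ its cost is $\sum_{t=1}^T g_t(x_t)+\beta\sum_{t=1}^{T+1}|x_t-x_{t-1}|$. Online, $g_t$ is revealed at time $t$ and $x_t$ is chosen irrevocably before future functions are seen; the algorithm must end with total purchase 1 (buying whatever remains, forcibly, near the deadline if necessary). The competitive ratio of an algorithm ALG is $\sup_{\mathcal I}\mathrm{ALG}(\mathcal I)/\mathrm{OPT}(\mathcal I)$ over all instances, where OPT is the offline optimal cost. *)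

(* Defs.v *)
(* MathComp-Analysis, over an arbitrary R : realType *)
From HB Require Import structures.
From mathcomp Require Export all_boot all_order all_algebra.
From mathcomp Require Export all_classical all_reals all_analysis.
Export Order.TTheory GRing.Theory Num.Theory.
Export numFieldNormedType.Exports.

Set Implicit Arguments.
Unset Strict Implicit.
Unset Printing Implicit Defensive.

Local Open Scope classical_set_scope.
Local Open Scope ring_scope.

(* Principal branch: on [-1, +oo[ the map w |-> w e^w is a bijection onto
   [-1/e, +oo[. The value outside [-1/e, +oo[ is a dummy. *)
Definition lambertW (R : realType) (z : R) : R :=
  xget 0 [set w : R | -1 <= w /\ w * expR w = z].

(* Here 2 beta / U + L / U - 1 lies in ]-1, 0[, so that the argument of W lies in
   ]-1/e, 0[; the other real branch of W would give a negative number. *)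
Definition alpha (R : realType) (L U beta : R) : R :=
  (lambertW ((2 * beta / U + L / U - 1) * expR (2 * beta / U - 1))
     - 2 * beta / U + 1)^-1.

(* A cost function on [0, 1]; its values outside [0, 1] are unconstrained and
   play no role in any cost. For convex functions continuous on [0, 1],
   derivative bounds on ]0, 1[ pass to the one-sided derivatives at 0 and 1. *)
Definition cost_function (R : realType) (L U : R) (g : R -> R) : Prop :=
  [/\ @convex_function R R^o `[0, 1] g,
      {within `[0, 1], continuous g},
      forall x, x \in `[0, 1] -> 0 <= g x,
      g 0 = 0 &
      forall x, x \in `]0, 1[ -> derivable g x 1 /\ L <= derive1 g x <= U].

(* Times 1, ..., T are the ordinals 0, ..., T - 1. The condition on the sum says
   that a feasible solution exists. *)
Definition rate_constraints (R : realType) (T : nat) (d : 'I_T -> R) : Prop :=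
  (forall t, 0 < d t <= 1) /\ 1 <= \sum_(t < T) d t.

Definition feasible (R : realType) (T : nat) (d x : 'I_T -> R) : Prop :=
  (forall t, 0 <= x t <= d t) /\ \sum_(t < T) x t = 1.

(* x_k for 0 <= k <= T + 1, with x_0 = x_(T+1) = 0 *)
Definition padded (R : realType) (T : nat) (x : 'I_T -> R) (k : nat) : R :=
  if k is j.+1 then oapp x 0 (insub j) else 0.

Definition cost (R : realType) (beta : R) (T : nat) (g : T.-tuple (R -> R))
    (x : 'I_T -> R) : R :=
  \sum_(t < T) tnth g t (x t)
  + beta * \sum_(1 <= k < T.+2) `|padded x k - padded x k.-1|.

Definition opt (R : realType) (beta : R) (T : nat) (d : 'I_T -> R)
    (g : T.-tuple (R -> R)) : R :=
  inf [set cost beta g x | x in feasible d].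

(* A deterministic online algorithm knows T and d in advance and returns x_t as a
   function of g_1, ..., g_t; its own past decisions are determined by these. *)
Definition online_rule (R : realType) : Type :=
  forall T : nat, ('I_T -> R) -> seq (R -> R) -> R.

Definition decisions (R : realType) (A : online_rule R) (T : nat) (d : 'I_T -> R)
    (g : T.-tuple (R -> R)) (t : 'I_T) : R :=
  A T d (take t.+1 g).

Definition ocs_min_instance (R : realType) (L U : R) (T : nat) (d : 'I_T -> R)
    (g : T.-tuple (R -> R)) : Prop :=
  rate_constraints d /\ forall t, cost_function L U (tnth g t).

Definition online_algorithm (R : realType) (L U : R) (A : online_rule R) : Prop :=
  forall (T : nat) (d : 'I_T -> R) (g : T.-tuple (R -> R)),
    ocs_min_instance L U d g -> feasible d (decisions A d g).

Definition competitive_ratio (R : realType) (L U beta : R) (A : online_rule R) :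
    \bar R :=
  ereal_sup [set r | exists (T : nat) (d : 'I_T -> R) (g : T.-tuple (R -> R)),
    ocs_min_instance L U d g /\
    r = (cost beta g (decisions A d g) / opt beta d g)%:E].

(* Main.v *)
Require Import Defs.
From mathcomp Require Import ring lra zify.

(* All costs are linear, g(x) = p x, and all rates are 1. For each price p of a
   decreasing sequence, the adversary repeats p, and after any
   non-negligible purchase it inserts m copies of U before it resumes. Such a
   purchase therefore costs about p + 2 beta per unit: holding the position
   during the m copies of U is possible only for a position of size at most 1/m.
   Once p has been shown m times in a row with negligible purchases, the optimum
   is at most p + 2 beta / m, and the adversary moves to the next price.
   Stopping there and showing U until the deadline costs the algorithm about
   U - sum_(j <= i) (U - 2 beta - p_j) X_j, where X_j is the amount bought at
   p_j, and a ratio a bounds this by a p_i. With c_j = U - 2 beta - p_j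
   geometric, from U - 2 beta - U / alpha to U - 2 beta - L, summation by parts
   of these bounds gives sum_j X_j > 1 as soon as a < alpha. *)

Set Implicit Arguments.
Unset Strict Implicit.
Unset Printing Implicit Defensive.

Local Open Scope classical_set_scope.
Local Open Scope ring_scope.

(** * Cost of a history of prices *)

Section Histories.
Context {R : realType}.
Variables (beta : R) (x : seq R -> R).
Hypothesis beta_ge0 : 0 <= beta.

(* x s is the purchase at the last time of the price history s. *)
Definition bought (s : seq R) : R := \sum_(k < size s) x (take k.+1 s).

Definition hist_cost (s : seq R) : R :=
  \sum_(k < size s) (nth 0 s k * x (take k.+1 s)
                     + beta * `|x (take k.+1 s) - x (take k s)|).

(* In lower_cost, the position x s is credited with its switching cost
   beta * x s, which a later purchase may save; closed_cost instead charges the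
   return to 0. *)
Definition lower_cost (s : seq R) : R := hist_cost s - beta * x s.

Definition closed_cost (s : seq R) : R := hist_cost s + beta * x s.

Lemma bought_rcons s p : bought (rcons s p) = bought s + x (rcons s p).
Proof.
rewrite /bought size_rcons big_ord_recr /= take_oversize ?size_rcons //.
congr (_ + _); apply: eq_bigr => k _.
by rewrite -cats1 takel_cat // ltn_ord.
Qed.

Lemma hist_cost_rcons s p : hist_cost (rcons s p) =
  hist_cost s + p * x (rcons s p) + beta * `|x (rcons s p) - x s|.
Proof.
rewrite /hist_cost size_rcons big_ord_recr /= take_oversize ?size_rcons //.
have -> : take (size s) (rcons s p) = s by rewrite -cats1 take_size_cat.
rewrite nth_rcons ltnn eqxx addrA; congr (_ + _ + _).
apply: eq_bigr => k _.
by rewrite -cats1 nth_cat ltn_ord !takel_cat // ?ltn_ord // ltnW.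
Qed.

(** The switching term is at least [beta] times the increase of the position, so it pays for the
    change of the credit. *)
Lemma lower_cost_rcons s p :
  lower_cost s + p * x (rcons s p) <= lower_cost (rcons s p).
Proof.
rewrite /lower_cost hist_cost_rcons.
have : beta * (x (rcons s p) - x s) <= beta * `|x (rcons s p) - x s|.
  by rewrite ler_wpM2l // ler_norm.
lra.
Qed.

Lemma cat_nseqS (s : seq R) k p : s ++ nseq k.+1 p = rcons (s ++ nseq k p) p.
Proof. by rewrite -addn1 nseqD catA cats1. Qed.

Lemma lower_cost_cat_nseq s k p :
  lower_cost s + p * (bought (s ++ nseq k p) - bought s)
    <= lower_cost (s ++ nseq k p).
Proof.
elim: k => [|k IHk]; first by rewrite cats0 subrr mulr0 addr0.
rewrite cat_nseqS bought_rcons.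
have := lower_cost_rcons (s ++ nseq k p) p; lra.
Qed.

Lemma closed_cost_rcons s p :
  lower_cost s + (p + 2 * beta) * x (rcons s p) <= closed_cost (rcons s p).
Proof. by have := lower_cost_rcons s p; rewrite /lower_cost /closed_cost; lra. Qed.

Lemma closed_cost_rcons_same s p :
  closed_cost s + p * x (rcons s p) <= closed_cost (rcons s p).
Proof.
rewrite /closed_cost hist_cost_rcons.
have : beta * (x s - x (rcons s p)) <= beta * `|x (rcons s p) - x s|.
  by rewrite distrC ler_wpM2l // ler_norm.
lra.
Qed.

End Histories.

(** * The adversary's game on price histories *)

Section Game.
Context {R : realType}.
Variables (L U beta : R) (T : nat) (x : seq R -> R).
Hypothesis beta_ge0 : 0 <= beta.

Definition admissible (s : seq R) : bool :=
  (size s <= T)%N && all (fun p => L <= p <= U) s.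

Lemma admissible_catl s t : admissible (s ++ t) -> admissible s.
Proof.
rewrite /admissible size_cat all_cat => /andP[le_T /andP[-> _]].
by rewrite andbT (leq_trans (leq_addr _ _) le_T).
Qed.

Hypothesis x_ge0 : forall s, admissible s -> 0 <= x s.
Hypothesis bought_le1 : forall s, admissible s -> bought x s <= 1.

Local Notation Q := (bought x).
Local Notation G := (lower_cost beta x).
Local Notation H := (closed_cost beta x).

(* mu is the smallest position held before and during the k copies of U. *)
Lemma cost_up (s : seq R) (k : nat) : admissible (s ++ nseq k U) ->
  exists2 mu : R, k%:R * mu <= Q (s ++ nseq k U) - Q s &
    H s + U * (Q (s ++ nseq k U) - Q s) - 2 * beta * mu <= G (s ++ nseq k U) /\
    H s + U * (Q (s ++ nseq k U) - Q s) <= H (s ++ nseq k U).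
Proof.
elim: k => [|k IHk].
  by move=> _; exists (x s); rewrite cats0 /lower_cost /closed_cost ?mul0r ?subrr //;
    split; lra.
rewrite cat_nseqS => adm.
have adm' : admissible (s ++ nseq k U).
  by move: adm; rewrite -cats1; exact: admissible_catl.
have [mu muQ [Gmu Hmu]] := IHk adm'.
have := closed_cost_rcons_same x beta_ge0 (s ++ nseq k U) U.
have := lower_cost_rcons x beta_ge0 (s ++ nseq k U) U.
have := x_ge0 adm; rewrite bought_rcons.
have : G (rcons (s ++ nseq k U) U) = H (rcons (s ++ nseq k U) U)
    - 2 * beta * x (rcons (s ++ nseq k U) U).
  by rewrite /lower_cost /closed_cost; lra.
set y := x (rcons _ _); set s' := rcons _ _ => GH y_ge0 Gs Hs.
have [mu_y|y_mu] := lerP mu y.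
  exists mu; first by rewrite -natr1; lra.
  by split; lra.
exists y; last by split; lra.
rewrite -natr1 mulrDl mul1r.
have : k%:R * y <= k%:R * mu by rewrite ler_wpM2l // ltW.
lra.
Qed.

(** The position kept through all m copies is at most 1/m of the amount bought during them, so the
    credit that survives is at most [2 * beta / m] per unit bought. *)
Lemma lower_cost_up (s : seq R) (m : nat) : (0 < m)%N ->
  admissible (s ++ nseq m U) ->
  H s + (U - 2 * beta / m%:R) * (Q (s ++ nseq m U) - Q s)
    <= G (s ++ nseq m U).
Proof.
move=> m_gt0 /cost_up[mu muQ [Gmu _]]; apply: le_trans Gmu.
have : mu <= (Q (s ++ nseq m U) - Q s) / m%:R.
  by rewrite ler_pdivlMr ?ltr0n // mulrC.
move=> /(ler_wpM2l (mulr_ge0 (ler0n R 2) beta_ge0)).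
lra.
Qed.

Lemma bought_cat_nseq (s : seq R) k p : admissible (s ++ nseq k p) ->
  Q s <= Q (s ++ nseq k p).
Proof.
elim: k => [|k IHk]; first by rewrite cats0.
rewrite cat_nseqS => adm; rewrite bought_rcons.
have := x_ge0 adm.
have : Q s <= Q (s ++ nseq k p).
  by apply: IHk; move: adm; rewrite -cats1; exact: admissible_catl.
lra.
Qed.

(** In the first alternative the run stops at [i] and nearly [p + 2 * beta] is charged for each of
    its units. In the second only [p] is charged, but for an amount that a small [eps] makes
    negligible. *)
Lemma interrupted_or_complete (s : seq R) (p eps : R) (m j : nat) :
  (0 < m)%N -> 0 < eps ->
  admissible (s ++ nseq j p) ->
  (exists2 i, (i <= j)%N &
     eps <= Q (s ++ nseq i p) - Q s /\
     G s + (p + 2 * beta - 2 * beta / m%:R) * (Q (s ++ nseq i p) - Q s)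
       <= H (s ++ nseq i p)) \/
  (Q (s ++ nseq j p) - Q s <= eps * (m.+1%:R ^+ j - 1) /\
   G s + p * (Q (s ++ nseq j p) - Q s) <= G (s ++ nseq j p)).
Proof.
move=> m_gt0 eps_gt0.
have m_gt0R : (0 : R) < m%:R by rewrite ltr0n.
elim: j => [|j IHj]; first by right; rewrite cats0 expr0 !subrr !mulr0; split; lra.
rewrite cat_nseqS => adm.
have adm' : admissible (s ++ nseq j p).
  by move: adm; rewrite -cats1; exact: admissible_catl.
have [[i le_ij Hi]|[Qj Gj]] := IHj adm'.
  by left; exists i => //; rewrite leqW.
have := closed_cost_rcons x beta_ge0 (s ++ nseq j p) p.
have := lower_cost_rcons x beta_ge0 (s ++ nseq j p) p.
have := x_ge0 adm.
have := bought_cat_nseq adm'.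
set Y := Q (s ++ nseq j p) in Qj Gj *.
set y := x (rcons _ _); set s' := s ++ _ in Gj * => YQ y_ge0 Gy Hy.
(* Interrupting only when y >= m * (Y - Q s) makes the uncharged earlier
   purchases of the run a 1/m fraction, while the total of an uninterrupted run
   grows at most by a factor m + 1 at each step. *)
have [/andP[eps_y mY]|] := boolP ((eps <= y) && (m%:R * (Y - Q s) <= y)).
  left; exists j.+1 => //; rewrite cat_nseqS bought_rcons -/s' -/y -/Y.
  split; first lra.
  have : Y - Q s <= y / m%:R by rewrite ler_pdivlMr // mulrC.
  move=> /(ler_wpM2l (mulr_ge0 (ler0n R 2) beta_ge0)).
  have : 0 <= beta / m%:R * (Y - Q s).
    by rewrite mulr_ge0 ?subr_ge0 // divr_ge0 // ltW.
  lra.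
rewrite negb_and -!ltNge => y_small; right.
rewrite bought_rcons -/s' -/y -/Y; split; last lra.
have y_le : y <= eps + m%:R * (Y - Q s).
  have : 0 <= m%:R * (Y - Q s) by rewrite mulr_ge0 ?subr_ge0 // ltW.
  by case/orP: y_small; lra.
have : m.+1%:R * (Y - Q s) <= m.+1%:R * (eps * (m.+1%:R ^+ j - 1)).
  by rewrite ler_wpM2l.
(* With M = m + 1, M * eps * (M^j - 1) + eps equals eps * (M^(j+1) - m), and m >= 1. *)
rewrite exprS -natr1.
have : (1 : R) <= m%:R by rewrite ler1n.
move=> m_ge1.
have : eps * 1 <= eps * m%:R by rewrite ler_pM2l.
lra.
Qed.

(** Induction on [k], a bound on the interruptions still possible: each buys at least [eps], and
    only [1 - Q s] is left. A round takes at most m copies of [p] and m of [U]. [X] collects the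
    purchases at [p], [Y] those at the inserted [U]; [2 * beta * delta] covers the last,
    uninterrupted run. *)
Lemma price_level (p eps delta : R) (m : nat) : (0 < m)%N -> 0 < eps ->
  L <= p <= U -> L <= U -> eps * m.+1%:R ^+ m <= delta ->
  forall (k : nat) (s : seq R),
  (size s + k.+1 * (2 * m) <= T)%N -> all (fun p => L <= p <= U) s ->
  1 - Q s <= k%:R * eps ->
  exists (e : seq R) (X Y : R),
  [/\ admissible (s ++ e ++ nseq m p),
      (size e + m <= k.+1 * (2 * m))%N,
      0 <= X, 0 <= Y &
      Q (s ++ e ++ nseq m p) = Q s + X + Y /\
      G s + (p + 2 * beta - 2 * beta / m%:R) * X + (U - 2 * beta / m%:R) * Y
        - 2 * beta * delta <= G (s ++ e ++ nseq m p)].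
Proof.
move=> m_gt0 eps_gt0 pLU LU eps_delta.
have bm_ge0 : 0 <= 2 * beta / m%:R by rewrite divr_ge0 ?mulr_ge0.
have UU : L <= U <= U by rewrite LU lexx.
elim/ltn_ind=> k IHk s sizes alls Qs.
have adm i : (i <= m)%N -> admissible (s ++ nseq i p).
  rewrite /admissible all_cat alls all_nseq pLU orbT andbT size_cat size_nseq.
  by move: sizes; clear; rewrite ?mulSn; lia.
have [[i le_im [epsQ Hi]]|[Qm Gm]] :=
  interrupted_or_complete m_gt0 eps_gt0 (adm _ (leqnn m)); last first.
  have X_ge0 : 0 <= Q (s ++ nseq m p) - Q s.
    by rewrite subr_ge0 bought_cat_nseq // adm.
  exists [::], (Q (s ++ nseq m p) - Q s), 0; split => //=; first exact: adm.
    by clear; rewrite ?mulSn; lia.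
  split; first by rewrite addr0 addrC subrK.
  have QD : Q (s ++ nseq m p) - Q s <= delta by lra.
  have := ler_wpM2l (mulr_ge0 (ler0n R 2) beta_ge0) QD.
  have := mulr_ge0 bm_ge0 X_ge0.
  lra.
have adm1 := adm _ le_im.
set s1 := s ++ nseq i p in epsQ Hi adm1.
(* For [k = 0] an interruption would push the total above 1. *)
case: k IHk sizes Qs => [|k] IHk sizes Qs; first by have := bought_le1 adm1; lra.
have adm2 : admissible (s1 ++ nseq m U).
  case/andP: adm1 => _ all1.
  rewrite /admissible all_cat all1 all_nseq UU orbT andbT !size_cat !size_nseq.
  by move: sizes le_im; clear; rewrite ?mulSn; lia.
have G2 := lower_cost_up m_gt0 adm2.
have Q2 := bought_cat_nseq adm2.
case/andP: (adm2) => _ all2.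
have [||e [X [Y [adm3 size3 X_ge0 Y_ge0 [Q3 G3]]]]] := IHk k (ltnSn k) _ _ all2.
- rewrite !size_cat !size_nseq; move: sizes le_im; clear; rewrite ?mulSn; lia.
- by move: Qs; rewrite -natr1; lra.
exists (nseq i p ++ nseq m U ++ e), (Q s1 - Q s + X),
  (Q (s1 ++ nseq m U) - Q s1 + Y).
have -> : s ++ (nseq i p ++ nseq m U ++ e) ++ nseq m p =
  (s1 ++ nseq m U) ++ e ++ nseq m p by rewrite /s1 !catA.
split => //.
- by rewrite !size_cat !size_nseq; move: size3 le_im; clear; rewrite ?mulSn; lia.
- lra.
- lra.
split; first by rewrite Q3; lra.
lra.
Qed.

(** Put c_i = c0 * q^i. A unit bought at level i costs about U - c_i, so stopping there costs about
    U - S with S the sum of the c_j X_j for j <= i. The ratio bound then reads S >= D + a * c_i,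
    where [err] gathers all approximation losses. *)
Lemma geometric_phases (a c0 q eps delta kappa err D : R) (m n k : nat) :
    x [::] = 0 -> (0 < m)%N -> 0 < eps -> 1 <= k%:R * eps ->
    eps * m.+1%:R ^+ m <= delta ->
    0 <= a -> 0 < c0 -> 1 <= q -> L <= U -> 0 <= delta ->
    (forall i, (i <= n)%N -> L <= U - 2 * beta - c0 * q ^+ i <= U) ->
    (n.+1 * (k.+1 * (2 * m)) <= T)%N ->
    (forall e p, admissible (e ++ nseq m p) ->
       G (e ++ nseq m p) + U * (1 - Q (e ++ nseq m p)) <= a * (p + kappa)) ->
    kappa = 2 * beta / m%:R ->
    err = kappa + 2 * beta * delta * n.+1%:R + a * kappa ->
    D = U - err - a * (U - 2 * beta) ->
  D / c0 + a + n%:R * (a * (1 - q^-1)) <= 1.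
Proof.
move=> x0 m_gt0 eps_gt0 k_eps eps_delta a_ge0 c0_gt0 q_ge1 LU delta_ge0 pLU sizeT.
move=> ratio kappaE errE DE.
have q_gt0 : 0 < q by rewrite (lt_le_trans ltr01).
have c_gt0 i : 0 < c0 * q ^+ i by rewrite mulr_gt0 ?exprn_gt0.
have kappa_ge0 : 0 <= kappa by rewrite kappaE divr_ge0 ?mulr_ge0.
have S_lb s i S : (i <= n)%N ->
    admissible (s ++ nseq m (U - 2 * beta - c0 * q ^+ i)) ->
    U * Q (s ++ nseq m (U - 2 * beta - c0 * q ^+ i)) - S
      - kappa * Q (s ++ nseq m (U - 2 * beta - c0 * q ^+ i))
      - 2 * beta * delta * i.+1%:R <= G (s ++ nseq m (U - 2 * beta - c0 * q ^+ i)) ->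
    D + a * (c0 * q ^+ i) <= S.
  move=> le_in adm GS.
  have := ratio _ _ adm.
  have := ler_wpM2l kappa_ge0 (bought_le1 adm).
  have : 2 * beta * delta * i.+1%:R <= 2 * beta * delta * n.+1%:R.
    by rewrite ler_wpM2l ?mulr_ge0 // ler_nat.
  rewrite DE errE; lra.
(* [W] is the sum of the X_j. Summation by parts becomes an induction through W - (S - D) / c_i,
   whose lower bound gains a * (1 - 1/q) per level; at i = n, (S - D) / c_n >= a and W <= 1
   conclude. *)
suff /(_ n (leqnn n)) [s [W [S [adm WQ GS inv SD]]]] : forall i, (i <= n)%N ->
    exists s W S,
    [/\ [/\ admissible s, (size s <= i.+1 * (k.+1 * (2 * m)))%N & 0 <= W],
        W <= Q s,
        U * Q s - S - kappa * Q s - 2 * beta * delta * i.+1%:R <= G s,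
        D / c0 + i%:R * (a * (1 - q^-1)) <= W - (S - D) / (c0 * q ^+ i) &
        D + a * (c0 * q ^+ i) <= S].
  have : a <= (S - D) / (c0 * q ^+ n) by rewrite ler_pdivlMr //; lra.
  by case: adm => /bought_le1; lra.
elim=> [|i IHi] le_in.
  have [||e [X [Y [adm sizes X_ge0 Y_ge0 [QE GE]]]]] :=
    price_level m_gt0 eps_gt0 (pLU _ le_in) LU eps_delta (k := k) (s := [::]) _ isT.
  - by move: sizeT; clear; rewrite mulSn /= add0n; apply: leq_trans; exact: leq_addr.
  - by rewrite /bought big_ord0 subr0.
  rewrite cat0s in adm QE GE.
  have Q0 : Q [::] = 0 by rewrite /bought big_ord0.
  have G0 : G [::] = 0 by rewrite /lower_cost /hist_cost big_ord0 x0 mulr0 subr0.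
  have GS : U * Q (e ++ nseq m (U - 2 * beta - c0 * q ^+ 0)) - c0 * X
      - kappa * Q (e ++ nseq m (U - 2 * beta - c0 * q ^+ 0))
      - 2 * beta * delta * 1%:R <= G (e ++ nseq m (U - 2 * beta - c0 * q ^+ 0)).
    move: GE; rewrite QE -kappaE; apply: le_trans; rewrite expr0 mulr1 Q0 G0; lra.
  exists (e ++ nseq m (U - 2 * beta - c0 * q ^+ 0)), X, (c0 * X).
  split => //.
  - by split=> //; rewrite mul1n size_cat size_nseq.
  - by rewrite QE Q0; lra.
  - by rewrite expr0 mulr1 mul0r mulrBl mulrAC divff ?gt_eqF // mul1r; lra.
  - exact: S_lb GS.
have [s [W [S [[adm size1 W_ge0] WQ GS inv SD]]]] := IHi (ltnW le_in).
have [||e [X [Y [adm' size' X_ge0 Y_ge0 [QE GE]]]]] :=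
    price_level m_gt0 eps_gt0 (pLU _ le_in) LU eps_delta (k := k) (s := s) _
      (andP adm).2.
- apply: leq_trans sizeT; apply: (@leq_trans (i.+2 * (k.+1 * (2 * m)))).
    by rewrite [leqRHS]mulSn addnC leq_add2l.
  by rewrite leq_mul2r ltnS le_in orbT.
- lra.
set p := U - 2 * beta - _ in adm' QE GE.
have GS' : U * Q (s ++ e ++ nseq m p) - (S + c0 * q ^+ i.+1 * X)
      - kappa * Q (s ++ e ++ nseq m p)
      - 2 * beta * delta * i.+2%:R <= G (s ++ e ++ nseq m p).
  move: GE; rewrite QE -kappaE; apply: le_trans; rewrite -[in i.+2%:R]natr1 /p; lra.
exists (s ++ e ++ nseq m p), (W + X), (S + c0 * q ^+ i.+1 * X).
split => //.
- split=> //; last exact: addr_ge0.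
  by rewrite mulSn addnC !size_cat size_nseq leq_add.
- lra.
- move: inv; rewrite -natr1.
  have : a <= (S - D) / (c0 * q ^+ i) by rewrite ler_pdivlMr //; lra.
  have qV_le1 : 0 <= 1 - q^-1 by rewrite subr_ge0 invf_le1.
  move=> /(ler_wpM2r qV_le1).
  (* The new purchase X cancels against its share in [W]; what remains is the gain (S - D) / c_i *
     (1 - 1/q). *)
  have -> : (S + c0 * q ^+ i.+1 * X - D) / (c0 * q ^+ i.+1) =
      (S - D) / (c0 * q ^+ i) / q + X.
    by rewrite exprSr; field; rewrite !gt_eqF ?exprn_gt0.
  lra.
- by rewrite catA in adm' GS'; exact: S_lb GS'.
Qed.

End Game.

(** * The value of alpha *)

(** After division by e^w, the bound e^(v - w) >= 1 + v - w reduces the claim to (w - v) * (1 + v)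
    >= 0. *)
Lemma mul_expR_le (R : realType) (v w : R) : -1 <= v -> v <= w -> w < 0 ->
  v * expR v <= w * expR w.
Proof.
move=> v_ge v_le_w w_lt0.
have -> : expR v = expR w * expR (v - w) by rewrite -expRD addrC subrK.
have : 1 + (v - w) <= expR (v - w) by exact: expR_ge1Dx.
have /ler_wnM2l : v <= 0 by lra.
move=> /[apply] le_v.
have : v * expR (v - w) <= w.
  apply: le_trans le_v _.
  have : 0 <= (w - v) * (1 + v) by rewrite mulr_ge0 ?subr_ge0 //; lra.
  lra.
move=> /(ler_wpM2r (expR_ge0 w)); lra.
Qed.

(** The intermediate value theorem on [-a, 0] shows that the set chosen from is inhabited, so the
    default of [xget] is avoided; monotonicity excludes w <= -a for the chosen point. *)
Lemma lambertW_spec (R : realType) (a l : R) : a <= 1 -> 0 < l < a ->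
  let w := lambertW ((l - a) * expR (- a)) in
  [/\ - a < w, w < 0 & w * expR w = (l - a) * expR (- a)].
Proof.
move=> a_le1 /andP[l_gt0 l_lt_a] w.
set z := (l - a) * _ in w *.
have z_lt0 : z < 0 by rewrite pmulr_llt0 ?expR_gt0 // subr_lt0.
have z_gt : - a * expR (- a) < z by rewrite ltr_pM2r ?expR_gt0 //; lra.
have [v vI vz] : exists2 v : R, v \in `[- a, 0] & v * expR v = z.
  apply: (@IVT R (fun v => v * expR v)).
  - by rewrite oppr_le0; lra.
  - apply: continuous_subspaceT => u; apply: cvgM; first exact: cvg_id.
    exact: continuous_expR.
  - by rewrite mul0r ge_min le_max; apply/andP; split;
    apply/orP; [left|right]; rewrite ltW.
have [w_ge wz] : -1 <= w /\ w * expR w = z.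
  apply: (xgetPex 0 (P := [set w : R | -1 <= w /\ w * expR w = z])).
  by exists v; split=> //; move: vI; rewrite in_itv /=; lra.
have w_lt0 : w < 0 by move: z_lt0; rewrite -wz pmulr_llt0 // expR_gt0.
split=> //; rewrite ltNge; apply/negP => w_le.
have := mul_expR_le w_ge w_le; rewrite wz; lra.
Qed.

(** The equation makes e^y the quotient of the last c_j by the first one, which determines the
    number of geometric steps of a given ratio. *)
Lemma alpha_spec (R : realType) (L U beta : R) : 0 < L -> L < U -> 0 < beta ->
  beta < (U - L) / 2 ->
  exists2 y, alpha L U beta = y^-1 &
    [/\ 0 < y, U * y < U - 2 * beta &
        (U - 2 * beta - U * y) * expR y = U - 2 * beta - L].
Proof.
move=> L_gt0 L_lt_U beta_gt0 beta_lt.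
have U_gt0 : 0 < U by lra.
(* With a = 1 - 2 * beta / U one has y = a + w, so the two strict bounds on y are -a < w and w <
   0. *)
have [||] := @lambertW_spec R (1 - 2 * beta / U) (L / U).
- by rewrite gerBl divr_ge0 // ltW //; lra.
- rewrite divr_gt0 //= ltrBrDr -mulrDl ltr_pdivrMr //; lra.
rewrite (_ : L / U - (1 - 2 * beta / U) = 2 * beta / U + L / U - 1); last by lra.
rewrite opprB /alpha; set w := lambertW _ => w_gt w_lt0 wE.
exists (w - 2 * beta / U + 1) => //; split; first by lra.
  have -> : U * (w - 2 * beta / U + 1) = U * w - 2 * beta + U.
    by field; rewrite gt_eqF.
  have : U * w < 0 by rewrite pmulr_rlt0.
  lra.
have -> : U * (w - 2 * beta / U + 1) = U * w - 2 * beta + U.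
  by field; rewrite gt_eqF.
rewrite (_ : w - _ + 1 = w - (2 * beta / U - 1)); last lra.
rewrite expRD expRN.
have -> : (U - 2 * beta - (U * w - 2 * beta + U)) *
     (expR w * (expR (2 * beta / U - 1))^-1) =
   - U * (w * expR w) / expR (2 * beta / U - 1) by lra.
rewrite wE; field; by rewrite !gt_eqF ?expR_gt0.
Qed.

(** * Linear cost functions *)

Definition linear_cost (R : realType) (p : R) : R -> R := fun x => p * x.

Lemma linear_cost_function (R : realType) (L U p : R) : 0 <= L -> L <= p <= U ->
  cost_function L U (linear_cost p).
Proof.
move=> L_ge0 /andP[Lp pU].
have der x : is_derive (x : R^o) 1 (linear_cost p : R^o -> R^o) p.
  by rewrite /linear_cost; apply: is_derive_eq;
    rewrite ?scaler1 ?mulr1 ?scaler0 ?addr0.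
split.
- move=> t x y _ _; rewrite /linear_cost.
  change (p * (t%:num * x + (1 - t%:num) * y) <=
    t%:num * (p * x) + (1 - t%:num) * (p * y)).
  by lra.
- apply: continuous_subspaceT => u; apply: cvgM; [exact: cvg_cst|exact: cvg_id].
- by move=> x; rewrite in_itv /= => /andP[x_ge0 _];
  rewrite mulr_ge0 // (le_trans L_ge0).
- by rewrite /linear_cost mulr0.
- move=> x _; split; first exact: ex_derive.
  by rewrite derive1E derive_val Lp.
Qed.

(** * Linear instances *)

Section Instances.
Context {R : realType}.
Variables (L U beta : R) (T : nat).
Hypotheses (L_gt0 : 0 < L) (beta_ge0 : 0 <= beta).

Definition linear_costs (s : T.-tuple R) : T.-tuple (R -> R) :=
  map_tuple (@linear_cost R) s.

Definition unit_rates : 'I_T -> R := fun=> 1.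

Lemma linear_instance (s : T.-tuple R) : (0 < T)%N ->
  all (fun p => L <= p <= U) s ->
  ocs_min_instance L U unit_rates (linear_costs s).
Proof.
move=> T_gt0 /all_tnthP Us; split.
  split=> [t|]; first by rewrite ltr01 lexx.
  by rewrite sumr_const card_ord ler1n.
by move=> t; rewrite tnth_map; apply: linear_cost_function (Us t); exact: ltW.
Qed.

(** Bounds below the set whose infimum is [opt], and later gives the positivity needed to divide by
    it. *)
Lemma cost_ge (s : T.-tuple R) x : all (fun p => L <= p <= U) s ->
  feasible unit_rates x -> L <= cost beta (linear_costs s) x.
Proof.
move=> /all_tnthP Us [x_ge0 x_sum]; rewrite -[leLHS]addr0 lerD //; last first.
  by rewrite mulr_ge0 // sumr_ge0.
rewrite -[leLHS]mulr1 -x_sum mulr_sumr ler_sum // => t _.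
rewrite tnth_map /linear_cost ler_wpM2r //.
  by case/andP: (x_ge0 t).
by case/andP: (Us t).
Qed.

Lemma opt_le (s : T.-tuple R) x : all (fun p => L <= p <= U) s ->
  feasible unit_rates x ->
  opt beta unit_rates (linear_costs s) <= cost beta (linear_costs s) x.
Proof.
move=> Us fx; apply: ge_inf; last by exists x.
by exists L => _ [y fy <-]; exact: cost_ge.
Qed.

Lemma opt_ge (s : T.-tuple R) x : all (fun p => L <= p <= U) s ->
  feasible unit_rates x -> L <= opt beta unit_rates (linear_costs s).
Proof.
move=> Us fx; apply: lb_le_inf; first by exists (cost beta (linear_costs s) x), x.
by move=> _ [y fy <-]; exact: cost_ge.
Qed.

(** * Offline purchase spread evenly over m consecutive times *)

Section Block.
Variables (a m : nat).
Hypothesis m_gt0 : (0 < m)%N.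

Definition block (k : nat) : R := if (a <= k < a + m)%N then m%:R^-1 else 0.

Lemma sum_block (c : nat -> R) (p : R) : (a + m <= T)%N ->
  (forall k, (a <= k < a + m)%N -> c k = p) ->
  \sum_(k < T) c k * block k = p.
Proof.
move=> am_T cp; rewrite -(big_mkord xpredT (fun k => c k * block k)).
rewrite (@big_cat_nat _ _ _ a) //=; last by lia.
rewrite [X in X + _]big_nat_cond big1 ?add0r; last first.
  move=> k; rewrite andbT => /andP[_ k_lt].
  by rewrite /block leqNgt k_lt mulr0.
rewrite (@big_cat_nat _ _ _ (a + m)) //=; last by lia.
rewrite [X in _ + X]big_nat_cond [X in _ + X]big1 ?addr0; last first.
  move=> k; rewrite andbT => /andP[k_ge _].
  by rewrite /block [(k < _)%N]ltnNge k_ge andbF mulr0.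
rewrite (eq_big_nat _ _ (F2 := fun=> p / m%:R)); last first.
  by move=> k k_in; rewrite /block k_in cp.
by rewrite sumr_const_nat addKn -[LHS]mulr_natr divfK // pnatr_eq0 -lt0n.
Qed.

Lemma block_feasible : (a + m <= T)%N ->
  feasible unit_rates (fun t : 'I_T => block t).
Proof.
move=> am_T; split=> [t|].
  rewrite /block; case: ifP => _; last by rewrite lexx ler01.
  by rewrite invr_ge0 ler0n invf_le1 ?ltr0n // ler1n.
rewrite -(sum_block (c := fun=> 1) am_T (fun _ _ => erefl)).
by apply: eq_bigr => t _; rewrite mul1r.
Qed.

(** Padding shifts indices by one: position [k.+1] belongs to the ordinal [k]. *)
Lemma padded_block (k : nat) : (a + m <= T)%N ->
  padded (fun t : 'I_T => block t) k = if (a < k <= a + m)%N then m%:R^-1 else 0.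
Proof.
move=> am_T; case: k => [//|k] /=; case: (ltnP k T) => kT; first by rewrite insubT.
rewrite insubF; last by rewrite ltnNge kT.
by rewrite [(k < _)%N]ltnNge (leq_trans am_T kT) andbF.
Qed.

Lemma switching_block : (a + m <= T)%N ->
  \sum_(1 <= k < T.+2) `|padded (fun t : 'I_T => block t) k
                         - padded (fun t : 'I_T => block t) k.-1| <= 2 / m%:R.
Proof.
move=> am_T.
have m_inv : (0 : R) <= m%:R^-1 by rewrite invr_ge0.
(* The position jumps only on entering and on leaving the block, by 1/m each time. *)
apply: (@le_trans _ _ (\sum_(1 <= k < T.+2)
    ((k == a.+1)%:R + (k == (a + m).+1)%:R) / m%:R)).
  apply: ler_sum_nat => -[//|k] _; rewrite !padded_block //= !eqSS ltnS.
  case: (ltngtP k a) => [ka|ka|->] /=.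
  - rewrite (ltn_eqF (ltn_addr m ka)) subrr normr0 addr0 mul0r //.
  - case: (ltngtP k (a + m)) => _; rewrite ?subrr ?normr0 ?addr0 ?mul0r //.
    by rewrite sub0r normrN add0r mul1r ger0_norm.
  - rewrite -{1}[a]addn0 ltn_add2l m_gt0 subr0 ger0_norm // mulrDl mul1r.
    by rewrite lerDl mulr_ge0.
rewrite -mulr_suml ler_wpM2r // big_split /= [leRHS](_ : 2 = 1 + 1) //.
have le1 b : \sum_(1 <= k < T.+2) (k == b)%:R <= 1 :> R.
  rewrite (eq_bigr (fun k => if k == b then 1%:R else 0));
    last by move=> k _; case: eqP.
  rewrite -big_mkcond -natr_sum sum1_count count_uniq_mem ?iota_uniq //.
  by rewrite lern1 leq_b1.
exact: lerD.
Qed.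

Lemma opt_block (s : T.-tuple R) (p : R) : all (fun p => L <= p <= U) s ->
  (a + m <= T)%N -> (forall k, (a <= k < a + m)%N -> nth 0 s k = p) ->
  opt beta unit_rates (linear_costs s) <= p + 2 * beta / m%:R.
Proof.
move=> Us am_T sp; apply: le_trans (opt_le Us (block_feasible am_T)) _.
apply: lerD.
  rewrite -(sum_block am_T sp) le_eqVlt; apply/orP; left; apply/eqP.
  by apply: eq_bigr => t _; rewrite tnth_map (tnth_nth 0).
have := ler_wpM2l beta_ge0 (switching_block am_T); lra.
Qed.

End Block.

(** * The online algorithm as a function of price histories *)

Variable A : online_rule R.
Hypothesis A_online : online_algorithm L U A.

(** The value 0 on the empty history encodes x_0 = 0. *)
Definition purchase (s : seq R) : R :=
  if s is [::] then 0 else A unit_rates (map (@linear_cost R) s).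

Lemma decisionsE (s : T.-tuple R) (t : 'I_T) :
  decisions A unit_rates (linear_costs s) t = purchase (take t.+1 s).
Proof.
rewrite /decisions /= -map_take /purchase.
by case: s => [[|p s]] //= /eqP sT; have := ltn_ord t; rewrite -{2}sT.
Qed.

Lemma padded_decisions (s : T.-tuple R) (k : nat) : (k <= T)%N ->
  padded (decisions A unit_rates (linear_costs s)) k = purchase (take k s).
Proof.
case: k => [|k] k_T /=; first by rewrite take0.
by rewrite insubT /= decisionsE.
Qed.

(** The last term of [closed_cost] is the switch from x_T back to x_(T+1) = 0. *)
Lemma cost_decisions (s : T.-tuple R) : (0 < T)%N ->
  all (fun p => L <= p <= U) s ->
  cost beta (linear_costs s) (decisions A unit_rates (linear_costs s)) =
  closed_cost beta purchase s.
Proof.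
move=> T_gt0 Us.
have [x_ge0 x_sum] := A_online (linear_instance T_gt0 Us).
rewrite /cost /closed_cost /hist_cost size_tuple big_split /= -addrA.
congr (_ + _).
  by apply: eq_bigr => t _; rewrite tnth_map (tnth_nth 0) decisionsE.
rewrite -mulr_sumr -mulrDr; congr (_ * _).
rewrite big_add1 big_nat_recr //= big_mkord; congr (_ + _).
  by apply: eq_bigr => t _; rewrite -(padded_decisions s (ltn_ord t))
    -(padded_decisions s (ltnW (ltn_ord t))).
rewrite insubF ?ltnn //= sub0r normrN padded_decisions //.
rewrite take_oversize ?size_tuple //.
rewrite ger0_norm //.
(* The whole history is seen as the prefix ending at the last time, so that feasibility gives the
   sign of its purchase. *)
have {1}<- : take (ord_max : 'I_T.-1.+1).+1 s = s.
  by rewrite take_oversize // size_tuple /= prednK.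
move: (ord_max : 'I_T.-1.+1); rewrite prednK // => t.
by rewrite -decisionsE; case/andP: (x_ge0 t).
Qed.

Lemma bought_full (s : T.-tuple R) : (0 < T)%N ->
  all (fun p => L <= p <= U) s -> bought purchase s = 1.
Proof.
move=> T_gt0 Us; have [_ <-] := A_online (linear_instance T_gt0 Us).
by rewrite /bought size_tuple; apply: eq_bigr => t _; rewrite decisionsE.
Qed.

(** Feasibility is known only for complete instances; this extension transfers it to partial
    histories. *)
Lemma complete_admissible (s : seq R) : L <= U -> admissible L U T s ->
  exists2 s' : T.-tuple R, val s' = s ++ nseq (T - size s) U &
    all (fun p => L <= p <= U) s'.
Proof.
move=> LU /andP[sT Us].
have sz : size (s ++ nseq (T - size s) U) == T by rewrite size_cat size_nseq subnKC.
by exists (Tuple sz) => //=; rewrite all_cat Us all_nseq LU lexx orbT.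
Qed.

Lemma purchase_ge0 (s : seq R) : L <= U -> admissible L U T s ->
  0 <= purchase s.
Proof.
move=> LU adm; have [s' s'E Us'] := complete_admissible LU adm.
case: s adm s'E => [|p s] // /andP[sT _] s'E.
have [x_ge0 _] := A_online (linear_instance (leq_ltn_trans (leq0n _) sT) Us').
have /andP[] := x_ge0 (Ordinal sT).
by rewrite decisionsE s'E take_size_cat.
Qed.

Lemma bought_purchase_le1 (s : seq R) : (0 < T)%N -> L <= U ->
  admissible L U T s -> bought purchase s <= 1.
Proof.
move=> T_gt0 LU adm; have [s' s'E Us'] := complete_admissible LU adm.
rewrite -(bought_full T_gt0 Us') s'E.
apply: (bought_cat_nseq (L := L) (U := U) (T := T)).
  by move=> t; exact: purchase_ge0.
by rewrite -s'E /admissible Us' size_tuple leqnn.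
Qed.

(** The history is completed with [U] until the deadline: the algorithm buys the rest at [U], while
    the optimum may use the block of m copies of [p]. *)
Lemma lower_cost_ratio (a : R) (m : nat) (e : seq R) (p : R) :
    (0 < T)%N -> (0 < m)%N -> L <= U -> 0 <= a ->
    (forall s : T.-tuple R, all (fun p => L <= p <= U) s ->
       closed_cost beta purchase s <= a * opt beta unit_rates (linear_costs s)) ->
    admissible L U T (e ++ nseq m p) ->
  lower_cost beta purchase (e ++ nseq m p)
    + U * (1 - bought purchase (e ++ nseq m p)) <= a * (p + 2 * beta / m%:R).
Proof.
move=> T_gt0 m_gt0 LU a_ge0 ratio adm.
have [s' s'E Us'] := complete_admissible LU adm.
have adm' : admissible L U T s' by rewrite /admissible Us' size_tuple leqnn.
have := ratio _ Us'.
have : opt beta unit_rates (linear_costs s') <= p + 2 * beta / m%:R.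
  apply: (@opt_block (size e) m m_gt0 s' p Us').
    by case/andP: adm; rewrite size_cat size_nseq.
  move=> k /andP[ek km]; rewrite s'E -catA nth_cat ltnNge ek /= nth_cat size_nseq.
  have lt_km : (k - size e < m)%N by rewrite ltn_subLR.
  by rewrite lt_km nth_nseq lt_km.
move=> /(ler_wpM2l a_ge0) opt_le opt_ge.
apply: le_trans (le_trans opt_ge opt_le).
have cost_ge : lower_cost beta purchase s' <= closed_cost beta purchase s'.
  have : 0 <= beta * purchase s' by rewrite mulr_ge0 // purchase_ge0.
  by rewrite /lower_cost /closed_cost; lra.
apply: le_trans cost_ge; rewrite -(bought_full T_gt0 Us') s'E.
exact: lower_cost_cat_nseq.
Qed.

Lemma closed_cost_ratio (s : T.-tuple R) (a : R) : (0 < T)%N ->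
  all (fun p => L <= p <= U) s -> (competitive_ratio L U beta A <= a%:E)%E ->
  closed_cost beta purchase s <= a * opt beta unit_rates (linear_costs s).
Proof.
move=> T_gt0 Us ratio_le; have inst := linear_instance T_gt0 Us.
have opt_gt0 := lt_le_trans L_gt0 (opt_ge Us (A_online inst)).
rewrite -cost_decisions // -ler_pdivrMr // -lee_fin.
apply: le_trans ratio_le; apply: ereal_sup_ubound.
by exists T, unit_rates, (linear_costs s).
Qed.

End Instances.

(** * Choice of the adversary's parameters *)

Lemma exists_div_lt (R : realType) (c e : R) : 0 <= c -> 0 < e ->
  exists2 n : nat, (0 < n)%N & c / n%:R < e.
Proof.
move=> c_ge0 e_gt0; exists (Num.bound (c / e)).+1 => //.
rewrite ltr_pdivrMr ?ltr0n // mulrC -ltr_pdivrMr //.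
apply: lt_le_trans (archi_boundP (divr_ge0 c_ge0 (ltW e_gt0))) _.
by rewrite ler_nat.
Qed.

Lemma no_ratio_below_alpha (R : realType) (L U beta : R)
    (L_gt0 : 0 < L) (L_lt_U : L < U)
    (beta_gt0 : 0 < beta) (beta_lt : beta < (U - L) / 2)
    (A : online_rule R) (A_online : online_algorithm L U A) (a : R) : 0 <= a ->
  (competitive_ratio L U beta A <= a%:E)%E ->
  alpha L U beta <= a.
Proof.
move=> a_ge0 ratio; rewrite leNgt; apply/negP => a_lt.
have [y alphaE [y_gt0 Uy yE]] := alpha_spec L_gt0 L_lt_U beta_gt0 beta_lt.
have U_gt0 : 0 < U := lt_trans L_gt0 L_lt_U.
have ay_lt1 : a * y < 1 by rewrite -ltr_pdivlMr // div1r -alphaE.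
pose c0 := U - 2 * beta - U * y.
have c0_gt0 : 0 < c0 by rewrite subr_gt0.
have Uy_gt0 : 0 < U * y by exact: mulr_gt0.
(* The limit excess over 1 of the left-hand side of [geometric_phases], without [err] and with n *
   (1 - 1/q) replaced by y. The choices of [n] and [m] each cost less than half of it. *)
pose gap := (1 - a * y) * (U / c0 - 1).
have gap_gt0 : 0 < gap.
  by rewrite mulr_gt0 ?subr_gt0 // ltr_pdivlMr // mul1r /c0; lra.
have gap2_gt0 : 0 < gap / 2 by rewrite divr_gt0.
have [n n_gt0 n_large] := exists_div_lt (mulr_ge0 a_ge0 (sqr_ge0 y)) gap2_gt0.
have [m m_gt0 m_large] : exists2 m : nat, (0 < m)%N &
    (2 + a) * (2 * beta) / c0 / m%:R < gap / 2.
  by apply: exists_div_lt => //; rewrite divr_ge0 // ?(ltW c0_gt0) //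
    !mulr_ge0 ?addr_ge0 // ltW.
pose kappa := 2 * beta / m%:R.
(* Chosen so that the losses [2 * beta * delta] of all n + 1 levels add up to [kappa]. *)
pose delta : R := (m%:R * n.+1%:R)^-1.
have delta_gt0 : 0 < delta by rewrite invr_gt0 mulr_gt0 ?ltr0n.
pose eps := delta / m.+1%:R ^+ m.
have mm_gt0 : (0 : R) < m.+1%:R ^+ m by rewrite exprn_gt0 ?ltr0n.
have eps_gt0 : 0 < eps by rewrite divr_gt0.
pose k := Num.bound eps^-1.
have k_eps : 1 <= k%:R * eps.
  by rewrite -ler_pdivrMr // div1r ltW // archi_boundP // invr_ge0 ltW.
(* By the equation for y, n steps of this ratio lead from c0 to U - 2 * beta - L, so the last price
   is L. *)
pose q := expR (y / n%:R).
have q_ge1 : 1 <= q by rewrite -expR0 ler_expR divr_ge0 // ltW.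
have qnE : c0 * q ^+ n = U - 2 * beta - L.
  by rewrite /q -expRM_natl [n%:R * _]mulrC divfK ?gt_eqF ?ltr0n.
pose T := (n.+1 * (k.+1 * (2 * m)))%N.
have T_gt0 : (0 < T)%N by rewrite !muln_gt0 m_gt0.
have LU := ltW L_lt_U.
have beta_ge0 := ltW beta_gt0.
have pLU i : (i <= n)%N -> L <= U - 2 * beta - c0 * q ^+ i <= U.
  move=> le_in; have : c0 * q ^+ i <= c0 * q ^+ n by rewrite ler_pM2l // ler_weXn2l.
  have : 0 < c0 * q ^+ i by rewrite mulr_gt0 // exprn_gt0 // expR_gt0.
  by rewrite qnE => c_gt0 c_le; apply/andP; split; lra.
have eps_delta : eps * m.+1%:R ^+ m <= delta by rewrite /eps divfK ?gt_eqF.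
have := @geometric_phases R L U beta T (purchase T A) beta_ge0
  (fun s => purchase_ge0 L_gt0 A_online LU)
  (fun s => bought_purchase_le1 L_gt0 A_online T_gt0 LU)
  a c0 q eps delta kappa _ _ m n k erefl m_gt0 eps_gt0 k_eps eps_delta a_ge0 c0_gt0
  q_ge1 LU (ltW delta_gt0) pLU (leqnn _)
  (fun e p => lower_cost_ratio L_gt0 beta_ge0 A_online T_gt0 m_gt0 LU a_ge0
    (fun s Us => closed_cost_ratio L_gt0 beta_ge0 A_online T_gt0 Us ratio))
  erefl erefl erefl.
apply/negP; rewrite -ltNge.
have errE : 2 * beta * delta * n.+1%:R = kappa.
  by rewrite /delta /kappa; field; rewrite !gt_eqF ?ltr0n.
rewrite errE.
(* With h = y / n, this follows from q >= 1 + h and (1 + h) * (1 - h + h^2) = 1 + h^3 >= 1. *)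
have qV : y / n%:R - (y / n%:R) ^+ 2 <= 1 - q^-1.
  have h_ge0 : 0 <= y / n%:R by rewrite divr_ge0 ?(ltW y_gt0).
  have q_gt0 : 0 < q := expR_gt0 _.
  suff : q^-1 <= 1 - y / n%:R + (y / n%:R) ^+ 2 by lra.
  rewrite -div1r ler_pdivrMr // -/q.
  have : 1 + y / n%:R <= q := expR_ge1Dx _.
  set h := y / n%:R in h_ge0 * => hq.
  have h2_gt0 : 0 <= 1 - h + h ^+ 2 by nra.
  have := ler_wpM2l h2_gt0 hq; have := exprn_ge0 3 h_ge0; lra.
have /(ler_wpM2l a_ge0)/(ler_wpM2l (ler0n R n)) := qV.
have -> : n%:R * (a * (y / n%:R - (y / n%:R) ^+ 2)) = a * y - a * y ^+ 2 / n%:R.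
  by field; rewrite gt_eqF ?ltr0n.
have -> : (U - (kappa + kappa + a * kappa) - a * (U - 2 * beta)) / c0 + a =
    gap + 1 - a * y - (2 + a) * (2 * beta) / c0 / m%:R.
  rewrite /gap; have c0_neq0 : c0 != 0 by rewrite gt_eqF.
  have -> : U - 2 * beta = c0 + U * y by rewrite /c0; lra.
  by rewrite /kappa; field; rewrite c0_neq0 gt_eqF ?ltr0n.
lra.
Qed.

Theorem theorem2 (R : realType) (L U beta : R)
    (L_gt0 : 0 < L) (L_lt_U : L < U)
    (beta_gt0 : 0 < beta) (beta_lt : beta < (U - L) / 2)
    (A : online_rule R) (A_online : online_algorithm L U A) :
  ((alpha L U beta)%:E <= competitive_ratio L U beta A)%E.
Proof.
rewrite leNgt; apply/negP => lt_alpha.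
have [y alphaE [y_gt0 _ _]] := alpha_spec L_gt0 L_lt_U beta_gt0 beta_lt.
have alpha_gt0 : 0 < alpha L U beta by rewrite alphaE invr_gt0.
(* The supremum is an extended real: [Num.max r 0] serves for a finite value r and 0 for -oo, while
   +oo contradicts [lt_alpha]. *)
suff [a [a_ge0 a_lt ratio]] : exists a, [/\ (0 : R) <= a, a < alpha L U beta &
    (competitive_ratio L U beta A <= a%:E)%E].
  have := no_ratio_below_alpha L_gt0 L_lt_U beta_gt0 beta_lt A_online a_ge0 ratio.
  by rewrite leNgt a_lt.
case: competitive_ratio lt_alpha => [r| |] // lt_alpha;
  last by exists 0; split=> //; rewrite leNye.
exists (Num.max r 0); rewrite le_max lexx orbT gt_max alpha_gt0 andbT.
by split=> //; rewrite lee_fin le_max lexx.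
Qed.
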